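(* Let $\mathfrak{S} = (X,\mathcal{U},\varphi)$ be a dynamical system with inputs. Then each of the following items is equivalent to $\mathfrak{S}$ being weakly input-to-state stable. (i) $\mathfrak{S}$ is uniformly globally stable and has the weak limit property. (ii) $\mathfrak{S}$ is uniformly globally stable and has the weak asymptotic gain property (that is, is of weak asymptotic gain). (iii) There exist $\sigma, \gamma \in \mathcal{K}$ and a function $\beta: X \times \mathcal{U} \times \mathbb{R}^+_0 \to \mathbb{R}^+_0$ with $\beta(x_0,u,\cdot) \in \mathcal{L}$ for all $x_0 \in X\setminus\{0\}$ and $u \in \mathcal{U}$, such that for all $(x_0,u) \in X \times \mathcal{U}$ and all $t \in \mathbb{R}^+_0$ $$\|\varphi(t,x_0,u)\| \le \beta(x_0,u,t) + \gamma(\|u\|_{\mathcal{U}}) \quad\text{and}\quad \beta(x_0,u,t) \le \sigma(\|x_0\|).$$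
   Context: Notation: $\mathbb{R}^+_0 = [0,\infty)$. $\mathcal{K}$ is the set of continuous strictly increasing functions $\gamma:\mathbb{R}^+_0\to\mathbb{R}^+_0$ with $\gamma(0)=0$; $\mathcal{L}$ is the set of continuous strictly decreasing functions $\gamma:\mathbb{R}^+_0\to\mathbb{R}^+_0$ with $\lim_{r\to\infty}\gamma(r)=0$. For functions $u_1,u_2$ on $\mathbb{R}^+_0$ and $\tau\in\mathbb{R}^+_0$, the concatenation $u_1\,\&_\tau u_2$ is defined by $(u_1\,\&_\tau u_2)(t)=u_1(t)$ for $t\in[0,\tau)$ and $=u_2(t-\tau)$ for $t\ge\tau$. Dynamical system with inputs: a triple $\mathfrak{S}=(X,\mathcal{U},\varphi)$, where $X$ is a normed linear space with norm $\|\cdot\|$; $\mathcal{U}$ is a non-empty set of functions $u:\mathbb{R}^+_0\to U$ endowed with a norm $\|\cdot\|_{\mathcal{U}}$ (meaning the restriction to $\mathcal{U}$ of a norm on some linear space containing $\mathcal{U}$; $\mathcal{U}$ itself need not be linear); and $\varphi:\mathbb{R}^+_0\times X\times\mathcal{U}\to X$ is a map, such that: (1) $u(\cdot+\tau)\in\mathcal{U}$ and $\|u(\cdot+\tau)\|_{\mathcal{U}}\le\|u\|_{\mathcal{U}}$ for all $u\in\mathcal{U}$, $\tau\ge0$; (2) $u_1\,\&_\tau u_2\in\mathcal{U}$ for all $u_1,u_2\in\mathcal{U}$, $\tau\ge0$; (3) $\varphi(0,x_0,u)=x_0$ and $\varphi(t+s,x_0,u)=\varphi(t,\varphi(s,x_0,u),u(\cdot+s))$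 for all $(x_0,u)\in X\times\mathcal{U}$, $s,t\ge0$; (4) $\varphi(\cdot,x_0,u):\mathbb{R}^+_0\to X$ is continuous for all $(x_0,u)$; (5) if $u_1|_{[0,\tau]}=u_2|_{[0,\tau]}$, then $\varphi(\cdot,x_0,u_1)|_{[0,\tau]}=\varphi(\cdot,x_0,u_2)|_{[0,\tau]}$, for all $x_0\in X$, $u_1,u_2\in\mathcal{U}$, $\tau\ge0$. Stability notions for $\mathfrak{S}$: - Uniformly globally stable: there exist $\underline\sigma,\underline\gamma\in\mathcal{K}$ such that $\|\varphi(t,x_0,u)\|\le\underline\sigma(\|x_0\|)+\underline\gamma(\|u\|_{\mathcal{U}})$ for all $(x_0,u)\in X\times\mathcal{U}$, $t\ge0$. - Of weak asymptotic gain: there is $\overline\gamma\in\mathcal{K}\cup\{0\}$ such that for every $\varepsilon>0$ and $(x_0,u)\in X\times\mathcal{U}$ there is $\overline\tau(\varepsilon,x_0,u)\in\mathbb{R}^+_0$ with $\|\varphi(t,x_0,u)\|\le\varepsilon+\overline\gamma(\|u\|_{\mathcal{U}})$ for all $t\ge\overline\tau(\varepsilon,x_0,u)$. - Weak limit property: there is $\overline\gamma\in\mathcal{K}$ such that for every $\varepsilon>0$ and $(x_0,u)\in X\times\mathcal{U}$ there is a time $\overline\tau(\varepsilon,x_0,u)\in\mathbb{R}^+_0$ with $\inf_{t\in[0,\overline\tau(\varepsilon,x_0,u)]}\|\varphi(t,x_0,u)\|\le\varepsilon+\overline\gamma(\|u\|_{\mathcal{U}})$. - Weakly input-to-state stable: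 uniformly globally stable and of weak asymptotic gain. *)

(* Defs.v *)
From HB Require Import structures.
From mathcomp Require Import all_boot all_order all_algebra.
From mathcomp Require Import interval_inference.
From mathcomp Require Import mathcomp_extra boolp classical_sets functions.
From mathcomp Require Import set_interval reals topology normedtype.

Set Implicit Arguments.
Unset Strict Implicit.
Unset Printing Implicit Defensive.

Import Order.TTheory GRing.Theory Num.Theory.
Import numFieldNormedType.Exports.

Local Open Scope classical_set_scope.
Local Open Scope ring_scope.

(* Functions from [0, +oo[ to [0, +oo[ are represented by maps R -> R of which
   only the restriction to [0, +oo[ matters. *)

(* Nonnegativity on [0, +oo[ follows from the last two conditions. *)
Definition classK (R : realType) (g : R -> R) : Prop :=
  [/\ {within `[0, +oo[, continuous g},
      {in `[0, +oo[ &, {homo g : r s / r < s}} &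
      g 0 = 0].

Definition classL (R : realType) (g : R -> R) : Prop :=
  [/\ {in `[0, +oo[, forall r, 0 <= g r},
      {within `[0, +oo[, continuous g},
      {in `[0, +oo[ &, {homo g : r s /~ r < s}} &
      g r @[r --> +oo] --> 0].

(* Inputs are functions on {nonneg R}, so that two inputs are equal exactly
   when they agree on [0, +oo[. *)
Definition input (R : realType) (U : Type) : Type := {nonneg R} -> U.

Definition shift (R : realType) (U : Type) (tau : {nonneg R})
    (u : input R U) : input R U :=
  fun t => u (t%:num + tau%:num)%:nng.

(* In the second branch t - tau is nonnegative, hence equal to its absolute
   value, which carries the sign information required by {nonneg R}. *)
Definition concat (R : realType) (U : Type) (tau : {nonneg R})
    (u1 u2 : input R U) : input R U :=
  fun t => if t%:num < tau%:num then u1 t else u2 `|t%:num - tau%:num|%:nng.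

(* The set of inputs need not be linear: it is identified, via the map [emb]
   (injective on it), with a subset of a normed space V, whose norm it
   inherits. The values of [emb] and [flow] at functions outside [inputs], and
   those of [flow] at negative times, are irrelevant. *)
Record system (R : realType) (X : normedModType R) (U : Type)
    (V : normedModType R) := System {
  inputs : set (input R U) ;
  emb : input R U -> V ;
  flow : R -> X -> input R U -> X ;
  inputs_nonempty : inputs !=set0 ;
  emb_inj : set_inj inputs emb ;
  inputs_shift : forall (u : input R U) (tau : {nonneg R}), inputs u ->
    inputs (shift tau u) /\ `|emb (shift tau u)| <= `|emb u| ;
  inputs_concat : forall (u1 u2 : input R U) (tau : {nonneg R}),
    inputs u1 -> inputs u2 -> inputs (concat tau u1 u2) ;
  flow0 : forall (x : X) (u : input R U), inputs u -> flow 0 x u = x ;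
  flowD : forall (x : X) (u : input R U) (s t : {nonneg R}), inputs u ->
    flow (t%:num + s%:num) x u = flow t%:num (flow s%:num x u) (shift s u) ;
  flow_continuous : forall (x : X) (u : input R U), inputs u ->
    {within `[0, +oo[, continuous (fun t : R => flow t x u)} ;
  flow_causal : forall (x : X) (u1 u2 : input R U) (tau : {nonneg R}),
    inputs u1 -> inputs u2 ->
    (forall t : {nonneg R}, t%:num <= tau%:num -> u1 t = u2 t) ->
    forall t : {nonneg R}, t%:num <= tau%:num ->
    flow t%:num x u1 = flow t%:num x u2
}.

Definition input_norm (R : realType) (X : normedModType R) (U : Type)
    (V : normedModType R) (S : system X U V) (u : input R U) : R :=
  `|emb S u|.

Definition uniformly_globally_stable (R : realType) (X : normedModType R)
    (U : Type) (V : normedModType R) (S : system X U V) : Prop :=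
  exists sigma gamma : R -> R, [/\ classK sigma, classK gamma &
    forall (x : X) (u : input R U) (t : R), inputs S u -> 0 <= t ->
    `|flow S t x u| <= sigma `|x| + gamma (input_norm S u)].

Definition weak_asymptotic_gain (R : realType) (X : normedModType R)
    (U : Type) (V : normedModType R) (S : system X U V) : Prop :=
  exists2 gamma : R -> R,
    classK gamma \/ {in `[0, +oo[, forall r, gamma r = 0} &
    forall (eps : R) (x : X) (u : input R U), 0 < eps -> inputs S u ->
    exists2 tau : R, 0 <= tau &
      forall t : R, tau <= t ->
      `|flow S t x u| <= eps + gamma (input_norm S u).

Definition weak_limit_property (R : realType) (X : normedModType R)
    (U : Type) (V : normedModType R) (S : system X U V) : Prop :=
  exists2 gamma : R -> R, classK gamma &
    forall (eps : R) (x : X) (u : input R U), 0 < eps -> inputs S u ->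
    exists2 tau : R, 0 <= tau &
      inf [set `|flow S t x u| | t in `[0, tau]]
        <= eps + gamma (input_norm S u).

Definition weakly_input_to_state_stable (R : realType) (X : normedModType R)
    (U : Type) (V : normedModType R) (S : system X U V) : Prop :=
  uniformly_globally_stable S /\ weak_asymptotic_gain S.

(* Main.v *)
Require Import Defs.
From HB Require Import structures.
From mathcomp Require Import all_boot all_order all_algebra.
From mathcomp Require Import interval_inference.
From mathcomp Require Import mathcomp_extra boolp classical_sets functions.
From mathcomp Require Import set_interval reals topology normedtype.
From mathcomp Require Import lra.

(** The gain in each property depends only on the norm of the input, whereas
    the times in the weak limit and weak asymptotic gain properties may depend
    on the state and on the input itself. This leaves room in two places.

    From the weak limit property to weak asymptotic gain
    ([weak_limit_asymptotic_gain]): the trajectory is at some time [s] of norm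
    at most slightly above [g |u|]. Restarting it there ([flow_restart])
    with the shifted input, whose norm is no larger, uniform
    global stability gives from then on the bound
    [sigma (d + g |u|) + gamma |u|], where [d] is as small as wanted.
    As [d] may depend on [u], continuity of [sigma] at the single point
    [g |u|] suffices to reach [eps + sigma (g |u|) + gamma |u|], and
    [sigma \o g + gamma] is the new gain. Conversely, a bound that holds from a
    time [tau] on holds at [tau], so it bounds the infimum over [0, tau].

    For the decay estimate, let [G] be the sum of the gains of the two
    properties. The excess of [|phi(t, x, u)|] over [G |u|], truncated at 0, is
    at most [sigma |x|] by stability and tends to 0 by asymptotic gain. Any
    such function has a majorant of class L bounded by [2 * sigma |x|]
    ([classL_majorant]), obtained as its smallest nonincreasing Lipschitz
    majorant for a fixed constant plus a strictly decreasing term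
    tending to 0; this is [beta x u]. The converse is read off the estimate,
    the state 0 being separate: there [beta <= sigma 0 = 0]. *)

Set Implicit Arguments.
Unset Strict Implicit.
Unset Printing Implicit Defensive.

Import Order.TTheory GRing.Theory Num.Theory.
Import numFieldNormedType.Exports.

Local Open Scope classical_set_scope.
Local Open Scope ring_scope.

(** * Functions of class K *)

Lemma classK_mono (R : realType) (g : R -> R) : classK g ->
  forall r s, 0 <= r -> r <= s -> g r <= g s.
Proof.
move=> [_ ginc _] r s r0; rewrite le_eqVlt => /predU1P[->//|rs].
by apply/ltW/ginc; rewrite // in_itv/= andbT//; lra.
Qed.

Lemma classK_ge0 (R : realType) (g : R -> R) (r : R) :
  classK g -> 0 <= r -> 0 <= g r.
Proof.
by move=> gK r0; have [_ _ g0] := gK; rewrite -[leLHS]g0; exact: classK_mono.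
Qed.

Lemma classK_gt0 (R : realType) (g : R -> R) (r : R) :
  classK g -> 0 < r -> 0 < g r.
Proof.
move=> [_ ginc g0] r0; rewrite -[ltLHS]g0.
by apply: ginc; rewrite // in_itv/= andbT//; lra.
Qed.

Lemma classK_id (R : realType) : classK (@id R).
Proof. by split=> //; apply: continuous_subspaceT => x; exact: cvg_id. Qed.

Lemma classKD (R : realType) (f g : R -> R) :
  classK f -> classK g -> classK (fun r => f r + g r).
Proof.
move=> [fc finc f0] [gc ginc g0]; split; last by rewrite f0 g0 addr0.
- exact: within_continuousD.
- by move=> r s r0 s0 rs; rewrite ltrD ?finc ?ginc.
Qed.

Lemma classK_comp (R : realType) (f g : R -> R) :
  classK f -> classK g -> classK (f \o g).
Proof.
move=> fK gK; have [fc finc f0] := fK; have [gc ginc g0] := gK.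
split; last by rewrite /= g0 f0.
- apply/subspace_continuousP => r r0.
  move/subspace_continuousP : fc => /(_ (g r)) fc.
  move/subspace_continuousP : (gc) => /(_ _ r0) {}gc.
  have gr0 : [set` `[0, +oo[] (g r).
    by move: r0; rewrite /= !in_itv/= !andbT => /(classK_ge0 gK).
  move/cvgrPdist_le : (fc gr0) => {}fc; apply/cvgrPdist_le => e /fc.
  rewrite near_withinE => -[d /= d0 fd].
  move/cvgrPdist_lt : gc => /(_ _ d0); rewrite !near_withinE.
  apply: filterS => s gs s0; apply: fd; first exact: gs.
  by move: s0; rewrite /= !in_itv/= !andbT => /(classK_ge0 gK).
- move=> r s r0 s0 rs; apply: finc; last exact: ginc.
  + by move: r0; rewrite !in_itv/= !andbT => /(classK_ge0 gK).
  + by move: s0; rewrite !in_itv/= !andbT => /(classK_ge0 gK).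
Qed.

Lemma classK_right_continuous (R : realType) (g : R -> R) (r e : R) :
  classK g -> 0 <= r -> 0 < e -> exists2 d, 0 < d & g (r + d) <= g r + e.
Proof.
move=> [gc _ _] r0 e0; have rI : [set` `[0, +oo[] r by rewrite /= in_itv/= r0.
move/subspace_continuousP : gc => /(_ _ rI) /cvgrPdist_le /(_ _ e0).
rewrite near_withinE => -[d /= d0 dP]; exists (d / 2); first by lra.
have rd : `|r - (r + d / 2)| < d.
  by rewrite opprD addrA subrr sub0r normrN gtr0_norm; lra.
have rdI : [set` `[0, +oo[] (r + d / 2).
  by rewrite /= in_itv/= andbT addr_ge0// divr_ge0// ltW.
have : `|g r - g (r + d / 2)| <= e := dP _ rd rdI.
by rewrite ler_norml => /andP[]; lra.
Qed.

(** * Majorants of class L *)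

Section lipschitz_envelope.
Context (R : realType) (f : R -> R) (M : R).
Context (M0 : 0 < M) (f_le : forall t, 0 <= t -> f t <= M).

(** This is the sup-convolution of [f] with [- M * max 0]. The kernel vanishes
    for [t <= s], which makes the envelope nonincreasing, and has slope [- M]
    for [t >= s], which makes it [M]-Lipschitz even where [f] jumps. *)
Definition envelope (t : R) : R :=
  sup [set f s - M * Num.max 0 (t - s) | s in `[0, +oo[].

Let max_ge0 (x : R) : 0 <= Num.max 0 x.
Proof. by rewrite le_max lexx. Qed.

Lemma le_envelope (t s : R) :
  0 <= s -> f s - M * Num.max 0 (t - s) <= envelope t.
Proof.
move=> s0; apply: ub_le_sup; last by exists s => //=; rewrite in_itv/= s0.
exists M => _ [r /= + <-]; rewrite in_itv/= andbT => r0.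
by have := mulr_ge0 (ltW M0) (max_ge0 (t - r)); have := f_le r0; lra.
Qed.

Lemma envelope_le (t y : R) :
  (forall s, 0 <= s -> f s - M * Num.max 0 (t - s) <= y) -> envelope t <= y.
Proof.
move=> fy; apply: ge_sup; first by exists (f 0 - M * Num.max 0 (t - 0)), 0;
  rewrite //= in_itv/= lexx.
by move=> _ [s /= + <-]; rewrite in_itv/= andbT => /fy.
Qed.

Lemma envelope_majorant (t : R) : 0 <= t -> f t <= envelope t.
Proof.
by move=> t0; have := le_envelope t t0; rewrite subrr maxxx mulr0 subr0.
Qed.

Lemma envelope_le_bound (t : R) : envelope t <= M.
Proof.
apply: envelope_le => s s0.
by have := mulr_ge0 (ltW M0) (max_ge0 (t - s)); have := f_le s0; lra.
Qed.

Lemma envelope_nincr : {homo envelope : r s /~ r <= s}.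
Proof.
move=> r s sr; apply: envelope_le => t t0.
apply: le_trans (le_envelope s t0); rewrite lerD2l lerN2 ler_pM2l//.
by rewrite ge_max max_ge0/= le_max; apply/orP; right; lra.
Qed.

Lemma envelope_lipschitz (r s : R) : `|envelope r - envelope s| <= M * `|r - s|.
Proof.
wlog rs : r s / r <= s.
  move=> H; have [|sr] := leP r s; first exact: H.
  by rewrite distrC (distrC r); apply: H; exact: ltW.
rewrite ger0_norm ?subr_ge0 ?envelope_nincr// distrC ger0_norm ?subr_ge0//.
rewrite lerBlDr; apply: envelope_le => t t0.
have max_lip : Num.max 0 (s - t) <= s - r + Num.max 0 (r - t).
  rewrite ge_max; apply/andP; split; first by have := max_ge0 (r - t); lra.
  have : r - t <= Num.max 0 (r - t) by rewrite le_max lexx orbT.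
  lra.
have : M * Num.max 0 (s - t) <= M * (s - r + Num.max 0 (r - t)).
  by rewrite ler_pM2l.
by have := le_envelope s t0; lra.
Qed.

Lemma envelope_continuous : continuous envelope.
Proof.
move=> r; apply/cvgrPdist_le => e e0; exists (e / M) => /=.
  exact: divr_gt0.
move=> s /= rs; apply: le_trans (envelope_lipschitz _ _) _.
by rewrite mulrC -ler_pdivlMr// ltW.
Qed.

(** As [f <= M], a time [s <= t - 1] contributes at most [M - M * 1 = 0] to the
    supremum, so only the values of [f] after time [t - 1] count. *)
Lemma envelope_tail (T e t : R) :
  0 <= e -> (forall s, T <= s -> f s <= e) -> T + 1 <= t -> envelope t <= e.
Proof.
move=> e0 fe Tt; apply: envelope_le => s s0; have [Ts|sT] := leP T s.
  by have := mulr_ge0 (ltW M0) (max_ge0 (t - s)); have := fe s Ts; lra.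
have : M * 1 <= M * Num.max 0 (t - s).
  by rewrite ler_pM2l// le_max; apply/orP; right; lra.
by have := f_le s0; lra.
Qed.

End lipschitz_envelope.

(** The envelope of [f] has every property of a function of class L except
    strict monotonicity, which the summand [M / (1 + t)] provides. The absolute
    value in the denominator makes that summand continuous on the whole line,
    so that continuity need not be restricted to the half-line. *)
Lemma classL_majorant (R : realType) (f : R -> R) (M : R) :
  0 < M -> (forall t, 0 <= t -> 0 <= f t <= M) ->
  (forall e, 0 < e -> exists2 T, 0 <= T & forall t, T <= t -> f t <= e) ->
  exists2 g, classL g & forall t, 0 <= t -> f t <= g t <= M + M.
Proof.
move=> M0 f0M f_to0.
have f0 t : 0 <= t -> 0 <= f t by move=> /f0M /andP[].
have fM t : 0 <= t -> f t <= M by move=> /f0M /andP[].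
have den0 (t : R) : 0 < 1 + `|t| by have := normr_ge0 t; lra.
have tail0 (t : R) : 0 < M / (1 + `|t|) by rewrite divr_gt0.
exists (fun t => envelope f M t + M / (1 + `|t|)); last first.
  move=> t t0; apply/andP; split.
    by have := envelope_majorant M0 fM t0; have := tail0 t; lra.
  apply: lerD; first exact: envelope_le_bound.
  by rewrite ler_pdivrMr// ler_peMr ?(ltW M0)//; have := normr_ge0 t; lra.
split.
- move=> t; rewrite in_itv/= andbT => t0.
  have := envelope_majorant M0 fM t0; have := f0 _ t0; have := tail0 t; lra.
- apply: continuous_subspaceT => t; apply: cvgD.
    exact: envelope_continuous.
  apply: cvgMr; apply: cvgV; first by rewrite gt_eqF.
  by apply: cvgD; [exact: cvg_cst|exact: norm_continuous].
- move=> r s; rewrite !in_itv/= !andbT => r0 s0 sr.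
  apply: ler_ltD; first by apply: envelope_nincr => //; exact: ltW.
  by rewrite ltr_pM2l// ltf_pV2 ?posrE// !ger0_norm// ltrD2l.
- apply/cvgrPdist_le => e e0; have [T T0 fT] := f_to0 (e / 2) ltac:(lra).
  near=> t.
  have t0 : 0 <= t by near: t; apply: nbhs_pinfty_ge; exact: num_real.
  have Tt : T + 1 <= t by near: t; apply: nbhs_pinfty_ge; exact: num_real.
  have Mt : M / (e / 2) <= t.
    by near: t; apply: nbhs_pinfty_ge; exact: num_real.
  have Et : envelope f M t <= e / 2 by apply: (envelope_tail M0 fM) fT Tt; lra.
  have : M / (1 + `|t|) <= e / 2.
    rewrite ler_pdivrMr// -ler_pdivrMl; last by lra.
    by rewrite mulrC ger0_norm//; lra.
  have := envelope_majorant M0 fM t0; have := f0 _ t0; have := tail0 t.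
  by rewrite sub0r normrN => *; rewrite ger0_norm; lra.
Unshelve. all: by end_near. Qed.

(** * Properties of trajectories *)

Section stability.
Context (R : realType) (X : normedModType R) (U : Type) (V : normedModType R).
Variable S : system X U V.

Lemma input_norm_ge0 (u : input R U) : 0 <= input_norm S u.
Proof. exact: normr_ge0. Qed.

(** The zero gain can be enlarged to the identity, so the asymptotic gain may
    always be taken in class K. *)
Lemma weak_asymptotic_gain_classK : weak_asymptotic_gain S ->
  exists2 gamma : R -> R, classK gamma &
    forall (eps : R) (x : X) (u : input R U), 0 < eps -> inputs S u ->
    exists2 tau : R, 0 <= tau &
      forall t : R, tau <= t ->
      `|flow S t x u| <= eps + gamma (input_norm S u).
Proof.
move=> [g [gK|g0] gP]; first by exists g.
exists id; first exact: classK_id.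
move=> e x u e0 uS; have [tau tau0 tauP] := gP e x u e0 uS.
exists tau => // t /tauP; rewrite g0 ?in_itv/= ?input_norm_ge0//.
by have := input_norm_ge0 u; lra.
Qed.

Lemma weak_asymptotic_gain_limit :
  weak_asymptotic_gain S -> weak_limit_property S.
Proof.
move=> /weak_asymptotic_gain_classK[g gK gP]; exists g => // e x u e0 uS.
have [tau tau0 tauP] := gP e x u e0 uS; exists tau => //.
apply: le_trans (tauP tau (lexx _)); apply: ge_inf.
  by exists 0 => _ [t _ <-].
by exists tau; rewrite //= in_itv/= tau0 lexx.
Qed.

(** Cocycle property in the form used below: the tail of a trajectory is a
    trajectory for an input of no larger norm. *)
Lemma flow_restart (x : X) (u : input R U) (s t : R) :
  inputs S u -> 0 <= s -> s <= t ->
  exists v : input R U, [/\ inputs S v, input_norm S v <= input_norm S u &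
    flow S t x u = flow S (t - s) (flow S s x u) v].
Proof.
move=> uS s0 st; have ts0 : 0 <= t - s by rewrite subr_ge0.
exists (Defs.shift (NngNum s0) u).
have [vS vu] := inputs_shift (NngNum s0) uS; split => //.
by rewrite -(flowD x (NngNum s0) (NngNum ts0) uS)/= subrK.
Qed.

(** Once the state is small, stability keeps it small: the weak limit property
    supplies one time at which it is, and [sigma] turns the bound at that time
    into a bound at all later ones. *)
Lemma weak_limit_asymptotic_gain : uniformly_globally_stable S ->
  weak_limit_property S -> weak_asymptotic_gain S.
Proof.
move=> [sigma [gamma [sK gK ugs]]] [g gK' gP].
exists (fun r => sigma (g r) + gamma r).
  by left; exact: classKD (classK_comp sK gK') gK.
move=> e x u e0 uS; set r := input_norm S u.
(* The tolerance [d] is chosen for this [u]; [sigma] need not be uniformly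
   continuous. *)
have gr0 : 0 <= g r by exact: (classK_ge0 gK' (input_norm_ge0 u)).
have [d d0 dP] := classK_right_continuous sK gr0 e0.
(* Only half of [d] goes into the weak limit property: an infimum strictly
   below [d + g r] is needed to find a time where the norm is below it. *)
have [tau tau0 tauP] := gP (d / 2) x u ltac:(lra) uS.
have [_ [s /=] + <- sP] :
    exists2 y, [set `|flow S t x u| | t in `[0, tau]] y & y < d + g r.
  apply: inf_lt; last by apply: le_lt_trans tauP _; rewrite ltrD2r; lra.
  by exists `|flow S 0 x u|, 0; rewrite //= in_itv/= lexx.
rewrite in_itv/= => /andP[s0 _]; exists s => // t st.
have [v [vS vu ->]] := flow_restart x uS s0 st.
apply: le_trans (ugs _ _ _ vS _) _; first by rewrite subr_ge0.
rewrite addrA lerD//; last exact: (classK_mono gK (input_norm_ge0 v) vu).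
rewrite [leRHS]addrC; apply: le_trans dP; apply: (classK_mono sK) => //.
by rewrite addrC ltW.
Qed.

Definition has_decay_estimate : Prop :=
  exists (sigma gamma : R -> R) (beta : X -> input R U -> R -> R),
    [/\ classK sigma,
        classK gamma,
        forall (x : X) (u : input R U) (t : R), inputs S u -> 0 <= t ->
          0 <= beta x u t,
        forall (x : X) (u : input R U), x != 0 -> inputs S u ->
          classL (beta x u) &
        forall (x : X) (u : input R U) (t : R), inputs S u -> 0 <= t ->
          `|flow S t x u| <= beta x u t + gamma (input_norm S u) /\
          beta x u t <= sigma `|x|].

(** The gain is the sum of the two gains because one function [beta] has to
    inherit both bounds: [sigma |x|] from stability and decay from asymptotic
    gain. The class L majorant costs a factor 2 on [sigma]. At [x = 0] the
    condition [beta <= sigma 0] forces [beta = 0]. *)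
Lemma wISS_decay_estimate :
  weakly_input_to_state_stable S -> has_decay_estimate.
Proof.
move=> [[sigma [gamma [sK gK ugs]]] /weak_asymptotic_gain_classK[g gK' wag]].
pose G r := gamma r + g r.
have bound x u t : inputs S u -> 0 <= t ->
    `|flow S t x u| <= sigma `|x| + G (input_norm S u).
  move=> uS t0; apply: le_trans (ugs _ _ _ uS t0) _; rewrite lerD2l /G.
  by have := classK_ge0 gK' (input_norm_ge0 u); lra.
have majorant (xu : X * input R U) : exists b : R -> R,
    xu.1 != 0 -> inputs S xu.2 -> classL b /\ forall t, 0 <= t ->
    `|flow S t xu.1 xu.2| <= b t + G (input_norm S xu.2) /\
    b t <= sigma `|xu.1| + sigma `|xu.1|.
  case: xu => x u /=.
  have [[x0 uS]|nP] := pselect (x != 0 /\ inputs S u); last first.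
    by exists (fun=> 0) => x0 uS; exfalso; apply: nP.
  pose f t := Num.max 0 (`|flow S t x u| - G (input_norm S u)).
  have sx0 : 0 < sigma `|x| by apply: classK_gt0 => //; rewrite normr_gt0.
  have [||b bL bP] := @classL_majorant R f _ sx0.
  - move=> t t0; rewrite le_max lexx/= ge_max ltW//=.
    by have := bound x u t uS t0; lra.
  - move=> e e0; have [T T0 TP] := wag e x u e0 uS; exists T => // t Tt.
    rewrite ge_max ltW//=; have := TP t Tt.
    by have := classK_ge0 gK (input_norm_ge0 u); rewrite /G; lra.
  exists b => _ _; split=> // t t0; have /andP[fb bM] := bP t t0; split=> //.
  by rewrite -lerBlDr; apply: le_trans fb; rewrite le_max lexx orbT.
have [b bP] := choice majorant.
exists (fun r => sigma r + sigma r), G,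
  (fun x u t => if x == 0 then 0 else b (x, u) t).
have [_ _ s0] := sK.
have zero u t : inputs S u -> 0 <= t -> `|flow S t 0 u| <= G (input_norm S u).
  by move=> uS t0; have := bound 0 u t uS t0; rewrite normr0 s0 add0r.
split; [exact: classKD|exact: classKD| | |].
- move=> x u t uS t0; case: eqVneq => // x0.
  by have [[+ _ _ _] _] := bP (x, u) x0 uS; apply; rewrite in_itv/= t0.
- by move=> x u x0 uS; rewrite (negbTE x0); have [] := bP (x, u) x0 uS.
- move=> x u t uS t0; case: eqVneq => [->|x0].
    split; first by rewrite add0r zero.
    by rewrite normr0 s0 addr0.
  by have [_] := bP (x, u) x0 uS; apply.
Qed.

Lemma decay_estimate_wISS :
  has_decay_estimate -> weakly_input_to_state_stable S.
Proof.
move=> [sigma [gamma [beta [sK gK b0 bL bP]]]]; split.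
  exists sigma, gamma; split=> // x u t uS t0.
  by have [+ bs] := bP x u t uS t0; lra.
exists gamma; first by left.
move=> e x u e0 uS; have [->|x0] := eqVneq x 0.
  exists 0 => // t t0; have [+] := bP 0 u t uS t0.
  by have [_ _ s0] := sK; rewrite normr0 s0; lra.
have [_ _ _ /cvgrPdist_le /(_ _ e0)[T [_ TP]]] := bL x u x0 uS.
exists (Num.max 0 (T + 1)); first by rewrite le_max lexx.
move=> t; rewrite ge_max => /andP[t0 Tt]; have [+ _] := bP x u t uS t0.
have := TP t ltac:(lra); rewrite sub0r normrN ler_norml => /andP[_].
lra.
Qed.

End stability.

Theorem theorem3p1 (R : realType) (X : normedModType R) (U : Type)
    (V : normedModType R) (S : system X U V) :
  [/\ weakly_input_to_state_stable S <->
        uniformly_globally_stable S /\ weak_limit_property S,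
      weakly_input_to_state_stable S <->
        uniformly_globally_stable S /\ weak_asymptotic_gain S &
      weakly_input_to_state_stable S <->
        exists (sigma gamma : R -> R) (beta : X -> input R U -> R -> R),
          [/\ classK sigma,
              classK gamma,
              forall (x : X) (u : input R U) (t : R), inputs S u -> 0 <= t ->
                0 <= beta x u t,
              forall (x : X) (u : input R U), x != 0 -> inputs S u ->
                classL (beta x u) &
              forall (x : X) (u : input R U) (t : R), inputs S u -> 0 <= t ->
                `|flow S t x u| <= beta x u t + gamma (input_norm S u) /\
                beta x u t <= sigma `|x|]].
Proof.
have wlp_wag : weakly_input_to_state_stable S <->
    uniformly_globally_stable S /\ weak_limit_property S.
  split=> -[ugs].
  - by move=> /weak_asymptotic_gain_limit.
  - by move=> /(weak_limit_asymptotic_gain ugs).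
split=> //; split; [exact: wISS_decay_estimate|exact: decay_estimate_wISS].
Qed.
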